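(* Let $k$ be a field, $A=k[x,y]$ the polynomial ring in two variables, and for each integer $n\ge1$ let $B_n=A\big[(x-1)/(x^ny-1)\big]\subset k(x,y)$. If $m,n\ge 1$ and $B_m\cong B_n$ as $k$-algebras, then $m=n$. *)

(* Defs.v *)
From HB Require Import structures.
From mathcomp Require Import all_boot all_order all_algebra.
Set Implicit Arguments. Unset Strict Implicit. Unset Printing Implicit Defensive.
Import Order.TTheory GRing.Theory Num.Theory.
Local Open Scope ring_scope.

(* A = k[x,y] is represented as {poly {poly k}}: the inner variable is x,
   the outer variable is y.  k(x,y) is its fraction field. *)
Definition Kxy (k : fieldType) := {fraction {poly {poly k}}}.

Definition polyx (k : fieldType) : {poly {poly k}} := ('X : {poly k})%:P.
Definition polyy (k : fieldType) : {poly {poly k}} := 'X.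

Definition inA (k : fieldType) (a : {poly {poly k}}) : Kxy k :=
  @FracField.tofrac _ a.
Definition kconst (k : fieldType) (c : k) : Kxy k := inA ((c%:P)%:P).

Definition tn (k : fieldType) (n : nat) : Kxy k :=
  inA (polyx k - 1) / inA (polyx k ^+ n * polyy k - 1).

Definition inB (k : fieldType) (n : nat) (f : Kxy k) : Prop :=
  exists p : {poly {poly {poly k}}}, f = (map_poly (@inA k) p).[tn k n].

(* P and Q (subrings of k(x,y) given as predicates) are isomorphic as
   k-algebras: there is a map which, restricted to P, is a unital ring
   morphism, k-linear, injective, with image exactly Q. *)
Definition kalg_iso (k : fieldType) (P Q : Kxy k -> Prop) : Prop :=
  exists f : Kxy k -> Kxy k,
    [/\ (forall a, P a -> Q (f a)),
        (forall a b, P a -> P b -> f (a + b) = f a + f b),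
        (forall a b, P a -> P b -> f (a * b) = f a * f b),
        f 1 = 1 &
        (forall (c : k) a, P a -> f (kconst c * a) = kconst c * f a)] /\
    (forall a b, P a -> P b -> f a = f b -> a = b) /\
    (forall b, Q b -> exists2 a, P a & f a = b).

(* Main.v *)
Require Import Defs.
From HB Require Import structures.
From mathcomp Require Import all_boot all_order all_algebra.
From mathcomp Require Import polyXY generic_quotient zify ring.
Set Implicit Arguments. Unset Strict Implicit. Unset Printing Implicit Defensive.
Import Order.TTheory GRing.Theory Num.Theory.
Local Open Scope ring_scope.

(* With [t = (x-1)/(x^n y-1)], the ring [B_n] is [k[x,y,t]] modulo
   [x^n y t = x + t - 1].  This is a smooth surface containing the torus
   [x t <> 0], and the Poisson bracket [(x^n y - 1) (df/dx dg/dy - df/dy dg/dx)]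
   of [k(x,y)] preserves [B_n], with values generating the unit ideal.
   Let [X], [Y], [Z] in [B_n] be the images of the generators of [B_m].  Since
   they satisfy the equation of [B_m] and generate [B_n], the bracket of [X] and
   [Z] is [u X^m Z] with [u] a unit of [B_n].  As the bracket of [x] and [t] is
   [- x^n t], the Laurent polynomial [u X^(m-1) / x^(n-1)] is, up to sign, the
   ratio of the logarithmic forms of [(X, Z)] and [(x, t)]; logarithmic
   derivatives have no pole along the toric divisors, so it is a constant.
   Comparing orders along [x = 0] gives [m - 1 | n - 1], and by symmetry
   [n - 1 | m - 1]. *)

(** * Weighted degrees and leading forms in two variables *)

Section Weights.
Variable k : fieldType.
Implicit Types (P Q S : {poly {poly k}}) (w : int * int) (r s : int).

(* [P`_i`_j] is the coefficient of [x^j y^i]. *)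
Definition wt w (i j : nat) : int := w.1 * i%:Z + w.2 * j%:Z.

(** This is an upper bound for the weighted degree, so it makes sense for [0]. It bounds the pole
    order along the toric divisor attached to [w]. *)
Definition fil w r P := forall i j, P`_i`_j != 0 -> wt w i j <= r.

Lemma fil0 w r : fil w r 0.
Proof. by move=> i j; rewrite !coef0 eqxx. Qed.

Lemma fil_le w r s P : r <= s -> fil w r P -> fil w s P.
Proof. by move=> le_rs filP i j /filP /le_trans; apply. Qed.

Lemma filD w r P Q : fil w r P -> fil w r Q -> fil w r (P + Q).
Proof.
move=> filP filQ i j; rewrite !coefD => nz.
have [P0|/filP //] := eqVneq P`_i`_j 0; apply: filQ.
by move: nz; rewrite P0 add0r.
Qed.

Lemma filN w r P : fil w r P -> fil w r (- P).
Proof. by move=> filP i j; rewrite !coefN oppr_eq0; apply: filP. Qed.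

Lemma filB w r P Q : fil w r P -> fil w r Q -> fil w r (P - Q).
Proof. by move=> filP filQ; apply: filD => //; apply: filN. Qed.

Lemma filM w r s P Q : fil w r P -> fil w s Q -> fil w (r + s) (P * Q).
Proof.
move=> filP filQ i j; apply: contraNT; rewrite -ltNge => lt_wt.
rewrite coefM coef_sum big1 // => -[a /= lt_a] _; rewrite coefM big1 //.
move=> -[b /= lt_b] _; apply/eqP; rewrite mulf_eq0; apply/norP=> -[/filP wP /filQ wQ].
have ei : i%:Z = a%:Z + (i - a)%N%:Z by lia.
have ej : j%:Z = b%:Z + (j - b)%N%:Z by lia.
have e : wt w i j = wt w a b + wt w (i - a) (j - b) by rewrite /wt ei ej; ring.
by move: lt_wt; rewrite e ltNge lerD.
Qed.

Lemma filX w r P n : fil w r P -> fil w (r * n%:Z) (P ^+ n).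
Proof.
move=> filP; elim: n => [|n IHn].
  move=> i j; rewrite expr0 coef1 mulr0; case: i => [|i]; last by rewrite coef0 eqxx.
  by rewrite coef1; case: j => [|j]; rewrite ?eqxx // /wt !mulr0.
by rewrite exprS intS mulrDr mulr1; apply: filM.
Qed.

Lemma fil_polyx w : fil w w.2 (polyx k).
Proof.
case=> [|i] [|[|j]]; rewrite ?coefC ?coefX ?coef0 ?eqxx //= => _.
by rewrite /wt mulr0 add0r mulr1.
Qed.

Lemma fil_polyy w : fil w w.1 (polyy k).
Proof.
case=> [|[|i]] [|j]; rewrite ?coefX ?coef1 ?coef0 ?eqxx //= => _.
by rewrite /wt mulr0 addr0 mulr1.
Qed.

Lemma fil_exists w P : exists r, fil w r P.
Proof.
exists (`|w.1| * (size P)%:Z + `|w.2| * (sizeY P)%:Z) => i j nz.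
have lt_i : (i < size P)%N.
  by rewrite ltnNge; apply: contra nz => /(nth_default 0)->; rewrite coef0.
have lt_j : (j < sizeY P)%N.
  rewrite ltnNge; apply: contra nz => le_j.
  by rewrite nth_default // (leq_trans (max_size_coefXY P i)).
rewrite /wt lerD //; rewrite (le_trans (ler_norm _)) // normrM ler_wpM2l //; lia.
Qed.

Definition top w r P :=
  \poly_(i < size P) \poly_(j < size P`_i) (if wt w i j == r then P`_i`_j else 0).

Lemma coef_top w r P i j :
  (top w r P)`_i`_j = if wt w i j == r then P`_i`_j else 0.
Proof.
rewrite coef_poly; case: ltnP => [_|ge_i].
  by rewrite coef_poly; case: ltnP => // ge_j; rewrite nth_default // if_same.
by rewrite coef0 (nth_default 0 ge_i) coef0 if_same.
Qed.

Lemma fil_top w r P : fil w r (top w r P).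
Proof. by move=> i j; rewrite coef_top; case: (wt w i j =P r) => [->|]; rewrite ?eqxx. Qed.

(** Together with [fil_top] this encodes homogeneity of weight [r] as two opposite bounds, so that
    [filM] also handles products of forms. *)
Lemma filN_top w r P : fil (- w.1, - w.2) (- r) (top w r P).
Proof.
move=> i j; rewrite coef_top; case: (wt w i j =P r) => [<- _|_]; last by rewrite eqxx.
by rewrite /wt /= opprD !mulNr.
Qed.

Lemma fil_subtop w r P : fil w r P -> fil w (r - 1) (P - top w r P).
Proof.
move=> filP i j; rewrite !coefB coef_top; case: (wt w i j =P r) => [_|ne].
  by rewrite subrr eqxx.
rewrite subr0 => /filP; lia.
Qed.

Lemma fil_eq0 w r P : fil w (r - 1) P -> fil (- w.1, - w.2) (- r) P -> P = 0.
Proof.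
move=> filP filNP; apply/polyP=> i; apply/polyP=> j; rewrite !coef0.
apply/eqP/negPn/negP=> nz; have := filP _ _ nz; have := filNP _ _ nz.
rewrite /wt /=; lia.
Qed.

(** Starting from any bound, lower [r] by one as long as the form of weight [r] vanishes; the weight
    of a fixed nonzero coefficient stops the descent. *)
Lemma fil_exact w P : P != 0 -> exists2 r, fil w r P & top w r P != 0.
Proof.
move=> nzP; have [i [j nz]] : exists i j, P`_i`_j != 0.
  exists (size P).-1, (size P`_(size P).-1).-1.
  by rewrite -!lead_coefE !lead_coef_eq0.
have [r0] := fil_exists w P; have [d] := ubnP `|r0 - wt w i j|%N.
elim: d r0 => // d IHd r lt_d filP.
have [t0|] := eqVneq (top w r P) 0; last by exists r.
have filP1 : fil w (r - 1) P by have := fil_subtop filP; rewrite t0 subr0.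
by apply: (IHd _ _ filP1); have := filP _ _ nz; have := filP1 _ _ nz; lia.
Qed.

(* Leading forms multiply to a nonzero form, since k[x,z] is a domain. *)
Lemma fil_cancel w r s P S :
  fil w r P -> top w r P != 0 -> fil w (s + r) (S * P) -> fil w s S.
Proof.
move=> filP nzP filSP; have [->|nzS] := eqVneq S 0; first exact: fil0.
have [s' filS nztS] := fil_exact w nzS.
have [|lt_s] := leP s' s; first by move/fil_le; apply.
(* For [s < s'] this product is the part of weight [s' + r] of [S * P], which the bound [s + r]
   forces to vanish. *)
suff /eqP : top w s' S * top w r P = 0 by rewrite mulf_eq0 (negPf nzP) (negPf nztS).
apply: (@fil_eq0 w (s' + r)); last first.
  by rewrite opprD; apply: filM; apply: filN_top.
have -> : top w s' S * top w r P =
  S * P - (S - top w s' S) * P - top w s' S * (P - top w r P) by ring.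
apply: filB; first apply: filB.
- apply: fil_le filSP; lia.
- by rewrite addrAC; apply: filM => //; apply: fil_subtop.
- rewrite -addrA; apply: filM; [exact: fil_top | exact: fil_subtop].
Qed.

(** The half-planes for the weights [(1, 0)], [(-1, 0)], [(0, 1)], [(0, -1)] already cut the Newton
    polygon down to one point. *)
Lemma fil_monomial a b S :
  (forall w, fil w (wt w a b) S) ->
  exists c, S = (c%:P)%:P * polyx k ^+ b * polyy k ^+ a.
Proof.
move=> filS; exists S`_a`_b; apply/polyP=> i; apply/polyP=> j.
rewrite -rmorphXn -rmorphM /= mulrC coefXnM.
have [[-> ->]|ne] := eqVneq (i, j) (a, b).
  by rewrite ltnn subnn coefC /= mulrC coefXnM ltnn subnn coefC.
have -> : S`_i`_j = 0.
  apply/eqP/negPn/negP=> nz.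
  have := filS (1, 0) _ _ nz; have := filS (-1, 0) _ _ nz.
  have := filS (0, 1) _ _ nz; have := filS (0, -1) _ _ nz.
  rewrite /wt /= => ? ? ? ?; case/negP: ne; apply/eqP; congr pair; lia.
case: ltnP => le_i; first by rewrite coef0.
rewrite coefC; case: eqP => e; last by rewrite coef0.
rewrite mulrC coefXnM; case: ltnP => // le_j; rewrite coefC.
case: eqP => // e'; case/eqP: ne; congr pair; lia.
Qed.

Definition dpolyx P := swapXY (swapXY P)^`().

Lemma dpolyxD : {morph dpolyx : P Q / P + Q}.
Proof. by move=> P Q; rewrite /dpolyx rmorphD derivD rmorphD. Qed.

Lemma dpolyxM P Q : dpolyx (P * Q) = dpolyx P * Q + P * dpolyx Q.
Proof. by rewrite /dpolyx rmorphM derivM rmorphD !rmorphM /= !swapXYK. Qed.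

Lemma fil_dpolyx w r P : fil w r P -> fil w r (polyx k * dpolyx P).
Proof.
move=> filP i j; rewrite mul_polyC coefZ coefXM.
case: j => [|j] /=; first by rewrite eqxx.
rewrite coef_swapXY coef_deriv coefMn coef_swapXY => nz; apply: filP.
by apply: contraNneq nz => ->; rewrite mul0rn.
Qed.

Lemma fil_deriv w r P : fil w r P -> fil w r (polyy k * P^`()).
Proof.
move=> filP i j; rewrite coefXM.
case: i => [|i] /=; first by rewrite coef0 eqxx.
rewrite coef_deriv coefMn => nz; apply: filP.
by apply: contraNneq nz => ->; rewrite mul0rn.
Qed.

Definition jac P Q := dpolyx P * Q^`() - P^`() * dpolyx Q.

(** The logarithmic derivations [x d/dx] and [y d/dy] multiply each monomial by a scalar, so they
    preserve every weight bound. *)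
Lemma fil_jac w r s P Q : fil w r P -> fil w s Q ->
  fil w (r + s) (polyx k * polyy k * jac P Q).
Proof.
move=> filP filQ; set x := polyx k; set y := polyy k.
have -> : x * y * jac P Q =
  (x * dpolyx P) * (y * Q^`()) - (y * P^`()) * (x * dpolyx Q).
  by rewrite /jac; ring.
by apply: filB; apply: filM; (apply: fil_dpolyx || apply: fil_deriv).
Qed.

End Weights.

(** * Derivations and their extension to the fraction field *)

Definition derivation (T : pzRingType) (D : T -> T) :=
  {morph D : a b / a + b} /\ (forall a b, D (a * b) = D a * b + a * D b).

Section Derivations.
Variables (T : comPzRingType) (D : T -> T).
Hypothesis derD : derivation D.

Lemma der0 : D 0 = 0.
Proof. by apply: (addrI (D 0)); rewrite -derD.1 !addr0. Qed.

Lemma der1 : D 1 = 0.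
Proof.
by apply: (addrI (D 1)); have := derD.2 1 1; rewrite !mulr1 mul1r addr0 => /esym.
Qed.

Lemma derN a : D (- a) = - D a.
Proof. by apply/eqP; rewrite -addr_eq0 -derD.1 addNr der0. Qed.

Lemma derX n a : D (a ^+ n.+1) = n.+1%:R * a ^+ n * D a.
Proof.
elim: n => [|n IHn]; first by rewrite expr1 expr0 !mul1r.
by rewrite exprS derD.2 IHn -[n.+2%:R]natr1 exprS; ring.
Qed.

End Derivations.

Section FractionDerivation.
Variables (R : idomainType) (D : R -> R).
Hypothesis derD : derivation D.
Local Notation "a %:F" := (@FracField.tofrac R a) : ring_scope.

(** The boolean form lets [xchoose] pick a numerator and a denominator in [frac_der]. *)
Lemma fracP (f : {fraction R}) :
  exists p : R * R, (p.2 != 0) && (f == p.1%:F / p.2%:F).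
Proof.
elim/quotW: f => r; exists (\n_r, \d_r); rewrite /= denom_ratioP /=.
apply/eqP/(canRL (mulfK _)); first by rewrite tofrac_eq0 denom_ratioP.
unlock FracField.tofrac; rewrite -[LHS]FracField.pi_mul.
apply/eqmodP; rewrite /= FracField.equivfE /FracField.mulf.
by rewrite !numden_Ratio ?oner_neq0 ?mulr1 ?denom_ratioP // mulrC.
Qed.

Definition frac_der (f : {fraction R}) : {fraction R} :=
  let: (a, b) := xchoose (fracP f) in
  (D a * b - a * D b)%:F / (b ^+ 2)%:F.

(** Independence of the chosen representative follows by applying [D] to the cross-multiplied
    equality [a * b' = a' * b]. *)
Lemma frac_derE a b : b != 0 ->
  frac_der (a%:F / b%:F) = (D a * b - a * D b)%:F / (b ^+ 2)%:F.
Proof.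
move=> nzb; rewrite /frac_der.
case: (xchoose _) (xchooseP (fracP (a%:F / b%:F))) => a' b' /= /andP[nzb' /eqP].
move/eqP; rewrite eqr_div ?tofrac_eq0 // -!rmorphM tofrac_eq => /eqP eq_ab.
apply/eqP; rewrite eqr_div ?tofrac_eq0 ?expf_neq0 // -!rmorphM tofrac_eq.
have := congr1 D eq_ab; rewrite !derD.2 => eqD; apply/eqP.
have -> : (D a' * b' - a' * D b') * b ^+ 2 =
  (D a' * b) * (b * b') - (a' * b) * (D b' * b) by ring.
have -> : D a' * b = D a * b' + a * D b' - a' * D b by rewrite eqD; ring.
rewrite -eq_ab; have -> : (D a * b' + a * D b' - a' * D b) * (b * b') =
  (D a * b' + a * D b') * (b * b') - (a' * b) * (D b * b') by ring.
by rewrite -eq_ab; ring.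
Qed.

Lemma frac_der_tofrac a : frac_der a%:F = (D a)%:F.
Proof.
have := @frac_derE a 1 (oner_neq0 _).
by rewrite (der1 derD) mulr0 subr0 expr1n rmorph1 !divr1 mulr1.
Qed.

Lemma frac_der_derivation : derivation frac_der.
Proof.
split=> f g; have [[a b] /= /andP[nzb /eqP->]] := fracP f;
  have [[c d] /= /andP[nzd /eqP->]] := fracP g.
- rewrite addf_div ?tofrac_eq0 // -!rmorphM -rmorphD /= !frac_derE ?mulf_neq0 //.
  rewrite addf_div ?tofrac_eq0 ?expf_neq0 // -!rmorphM -rmorphD /=.
  rewrite derD.1 !derD.2.
  by congr (_%:F / _%:F); ring.
- rewrite mulf_div -!rmorphM /= !frac_derE ?mulf_neq0 //.
  rewrite !mulf_div addf_div ?mulf_neq0 ?tofrac_eq0 ?expf_neq0 // -?rmorphM -?rmorphD /=.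
  apply/eqP; rewrite eqr_div ?tofrac_eq0 ?mulf_neq0 ?expf_neq0 //.
  rewrite -!rmorphM tofrac_eq !derD.2; apply/eqP; ring.
Qed.

End FractionDerivation.

Lemma deriv_derivation (k : nzRingType) : derivation (@deriv k).
Proof. by split; [exact: derivD | exact: derivM]. Qed.

Lemma dpolyx_derivation (k : fieldType) : derivation (@dpolyx k).
Proof. by split; [exact: dpolyxD | exact: dpolyxM]. Qed.

Lemma polyxy_ind (k : fieldType) (S : {poly {poly k}} -> Prop) :
    (forall c, S (c%:P)%:P) -> S (polyx k) -> S (polyy k) ->
    (forall a b, S a -> S b -> S (a + b)) ->
    (forall a b, S a -> S b -> S (a * b)) ->
  forall P, S P.
Proof.
move=> Sc Sx Sy SD SM; elim/poly_ind => [|P p IHP]; first exact: Sc 0.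
apply: (SD _ _ (SM _ _ IHP Sy)).
elim/poly_ind: p => [|p c IHp]; first exact: Sc 0.
by rewrite polyCD polyCM; apply: SD; first exact: SM.
Qed.

(** * The Poisson bracket attached to two derivations *)

Section Bracket.
Variables (F : fieldType) (D1 D2 : F -> F) (w : F).
Hypotheses (derD1 : derivation D1) (derD2 : derivation D2).
Implicit Types f g X Y Z : F.

Definition br f g := w * (D1 f * D2 g - D2 f * D1 g).

Lemma brD f f' g : br (f + f') g = br f g + br f' g.
Proof. by rewrite /br derD1.1 derD2.1; ring. Qed.

Lemma brM f f' g : br (f * f') g = f * br f' g + f' * br f g.
Proof. by rewrite /br derD1.2 derD2.2; ring. Qed.

Lemma brC f g : br f g = - br g f.
Proof. by rewrite /br; ring. Qed.

Lemma brr f : br f f = 0.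
Proof. by rewrite /br; ring. Qed.

Lemma br_eq0 c g : D1 c = 0 -> D2 c = 0 -> br c g = 0.
Proof. by move=> c1 c2; rewrite /br c1 c2; ring. Qed.

Lemma brN1 g : br (- 1) g = 0.
Proof. by rewrite br_eq0 ?(derN derD1) ?(derN derD2) ?(der1 derD1) ?(der1 derD2) ?oppr0. Qed.

Lemma brX f n g : br (f ^+ n.+1) g = n.+1%:R * f ^+ n * br f g.
Proof. by rewrite /br (derX derD1) (derX derD2); ring. Qed.

(** With [g] a common denominator of [X] and [Z], only brackets of numerators and denominator remain
    on the right. *)
Lemma br_quot g X Z : g ^+ 3 * br X Z =
  g * br (g * X) (g * Z) - g * X * br g (g * Z) - g * Z * br (g * X) g.
Proof. by rewrite /br !derD1.2 !derD2.2; ring. Qed.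

(** Bracketing the relation with each generator shows that the three brackets are the partial
    derivatives of [X^(m+1) Y Z - X - Z + 1] times a common factor [u]. The last identity writes [1]
    as a combination of these partials, which is the smoothness of the surface. *)
Lemma br_rel m X Y Z (u := br X Z / (X ^+ m.+1 * Z)) :
    X != 0 -> Z != 0 -> X ^+ m.+1 * Y * Z = X + Z - 1 ->
  [/\ br X Z = u * (X ^+ m.+1 * Z),
      br Z Y = u * (m.+1%:R * X ^+ m * Y * Z - 1),
      br Y X = u * (X ^+ m.+1 * Y - 1) &
      u = m.+1%:R * X ^+ m * Y * (Y * br X Z - Z * br Y X) - br Z Y].
Proof.
move=> nzX nzZ rel; have nzb : X ^+ m.+1 * Z != 0 by rewrite mulf_neq0 ?expf_neq0.
have eXZ : br X Z = u * (X ^+ m.+1 * Z) by rewrite mulfVK.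
have drel g : X ^+ m.+1 * Z * br Y g =
    - (m.+1%:R * X ^+ m * Y * Z - 1) * br X g - (X ^+ m.+1 * Y - 1) * br Z g.
  have := congr1 (br ^~ g) rel; rewrite /= !brD !brM brN1 brX addr0 => e.
  by apply/eqP; rewrite -subr_eq0; move/eqP: e; rewrite -subr_eq0 => /eqP <-; apply/eqP; ring.
have eZY : br Z Y = u * (m.+1%:R * X ^+ m * Y * Z - 1).
  by apply: (mulfI nzb); rewrite brC mulrN drel brr eXZ; ring.
have eYX : br Y X = u * (X ^+ m.+1 * Y - 1).
  by apply: (mulfI nzb); rewrite drel brr [br Z X]brC eXZ; ring.
by split=> //; rewrite eXZ eZY eYX exprS; ring.
Qed.

End Bracket.

(** * Subalgebras generated by three elements, and ideals containing their brackets *)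

Inductive gen (F : fieldType) (k : fieldType) (c : k -> F) (X Y Z : F) : F -> Prop :=
| genC a : gen c X Y Z (c a)
| genX : gen c X Y Z X
| genY : gen c X Y Z Y
| genZ : gen c X Y Z Z
| genD f g : gen c X Y Z f -> gen c X Y Z g -> gen c X Y Z (f + g)
| genM f g : gen c X Y Z f -> gen c X Y Z g -> gen c X Y Z (f * g).

Section Generated.
Variables (F k : fieldType) (c : {rmorphism k -> F}) (X Y Z : F).
Local Notation B := (gen c X Y Z).

Lemma gen1 : B 1. Proof. by rewrite -(rmorph1 c); apply: genC. Qed.

Lemma gen0 : B 0. Proof. by rewrite -(rmorph0 c); apply: genC. Qed.

Lemma genN f : B f -> B (- f).
Proof. by move=> Bf; rewrite -mulN1r -(rmorphN1 c); apply: genM => //; apply: genC. Qed.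

Lemma genB f g : B f -> B g -> B (f - g).
Proof. by move=> Bf Bg; apply: genD => //; apply: genN. Qed.

Lemma genXn f n : B f -> B (f ^+ n).
Proof.
move=> Bf; elim: n => [|n IHn]; first exact: gen1.
by rewrite exprS; apply: genM.
Qed.

Lemma gen_nat n : B n%:R. Proof. by rewrite -(rmorph_nat c); apply: genC. Qed.

Variables (D1 D2 : F -> F) (w : F).
Hypotheses (derD1 : derivation D1) (derD2 : derivation D2).
Hypotheses (D1c : forall a, D1 (c a) = 0) (D2c : forall a, D2 (c a) = 0).
Local Notation br := (br D1 D2 w).
Variable u : F.
Local Notation I := (fun f => exists2 v, B v & f = u * v).

Lemma idealD f g : I f -> I g -> I (f + g).
Proof. by move=> [v Bv ->] [v' Bv' ->]; exists (v + v'); [exact: genD | ring]. Qed.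

Lemma idealM f g : B f -> I g -> I (f * g).
Proof. by move=> Bf [v Bv ->]; exists (f * v); [exact: genM | ring]. Qed.

Lemma idealN f : I f -> I (- f).
Proof. by move=> [v Bv ->]; exists (- v); [exact: genN | ring]. Qed.

Lemma br_ideal_l g f : I (br X g) -> I (br Y g) -> I (br Z g) -> B f -> I (br f g).
Proof.
move=> IX IY IZ; elim=> {f} [a|||| f f' _ If _ If'| f f' Bf If Bf' If'] //.
- by rewrite br_eq0 ?D1c ?D2c //; exists 0; [exact: gen0 | rewrite mulr0].
- by rewrite brD //; apply: idealD.
- by rewrite brM //; apply: idealD; apply: idealM.
Qed.

(** By the Leibniz rule and antisymmetry, [u B] contains all brackets once it contains those of the
    generators. For [u = 1] this says that [B] is closed under the bracket. *)
Lemma br_ideal f g : I (br X Y) -> I (br Y Z) -> I (br X Z) -> B f -> B g -> I (br f g).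
Proof.
move=> IXY IYZ IXZ Bf Bg.
have Irr h : I (br h h) by rewrite brr; exists 0; [exact: gen0 | rewrite mulr0].
have IC h h' : I (br h h') -> I (br h' h) by rewrite [br h' h]brC; apply: idealN.
by apply: br_ideal_l => //; apply: (IC _ _); apply: br_ideal_l => //; apply: (IC _ _).
Qed.

End Generated.

(** * Comparison of two generating triples through the bracket *)

(* Here [{poly {poly k}}] is the coordinate ring of the plane with coordinates
   [x] and [t]: [polyy] stands for [t].  The exponents are [m.+1] and [n.+1]. *)
Section Rigidity.
Variables (F k : fieldType) (E : {rmorphism {poly {poly k}} -> F}).
Hypothesis injE : injective E.
Variables (c : {rmorphism k -> F}) (x t : F).
Hypotheses (Ec : forall a, E (a%:P)%:P = c a) (Ex : E (polyx k) = x) (Et : E (polyy k) = t).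
Variables (D1 D2 : F -> F) (w : F).
Hypotheses (derD1 : derivation D1) (derD2 : derivation D2).
Hypotheses (D1c : forall a, D1 (c a) = 0) (D2c : forall a, D2 (c a) = 0).
Local Notation br := (br D1 D2 w).

Lemma E_neq0 P : (E P != 0) = (P != 0).
Proof. by rewrite -(rmorph0 E) (inj_eq injE). Qed.

Lemma x_neq0 : x != 0.
Proof. by rewrite -Ex E_neq0 polyC_eq0 polyX_eq0. Qed.

Lemma t_neq0 : t != 0.
Proof. by rewrite -Et E_neq0 polyX_eq0. Qed.

Lemma dpolyx_const (a : k) : dpolyx (a%:P)%:P = 0.
Proof. by rewrite /dpolyx swapXY_polyC map_polyC derivC rmorph0. Qed.

Lemma dpolyx_x : dpolyx (polyx k) = 1.
Proof. by rewrite /dpolyx swapXY_Y derivX rmorph1. Qed.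

Lemma dpolyx_y : dpolyx (polyy k) = 0.
Proof. by rewrite /dpolyx swapXY_X derivC rmorph0. Qed.

Lemma der_E D P : derivation D -> (forall a, D (c a) = 0) ->
  D (E P) = E (dpolyx P) * D x + E P^`() * D t.
Proof.
move=> derD Dc; elim/polyxy_ind: P => [a|||P Q IHP IHQ|P Q IHP IHQ].
- by rewrite Ec Dc dpolyx_const derivC rmorph0 !mul0r addr0.
- by rewrite Ex dpolyx_x derivC rmorph0 rmorph1 mul0r addr0 mul1r.
- by rewrite Et dpolyx_y derivX rmorph0 rmorph1 mul0r add0r mul1r.
- by rewrite rmorphD derD.1 IHP IHQ dpolyxD derivD !rmorphD; ring.
- by rewrite rmorphM derD.2 IHP IHQ dpolyxM derivM !rmorphD !rmorphM; ring.
Qed.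

(** By the chain rule [der_E], passing to the coordinates [x], [t] multiplies the Jacobian by
    [br x t]. *)
Lemma br_E P Q : br (E P) (E Q) = br x t * E (jac P Q).
Proof.
rewrite /br !(der_E P derD1, der_E Q derD1, der_E P derD2, der_E Q derD2) //.
by rewrite /jac rmorphB !rmorphM; ring.
Qed.

Variables (m n : nat) (y X Y Z : F).
Local Notation B := (gen c x y t).
Hypotheses (rel_xyt : x ^+ n.+1 * y * t = x + t - 1).
Hypotheses (br_xt : br x t = - (x ^+ n.+1 * t)).
Hypotheses (rel_XYZ : X ^+ m.+1 * Y * Z = X + Z - 1).
Hypotheses (nzX : X != 0) (nzZ : Z != 0).
Hypothesis genXYZ : forall f, gen c X Y Z f <-> B f.

(** The brackets of elements of [B] lie in [B] and generate the unit ideal, as seen on [x], [y],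
    [t]; they all lie in [u B], as seen on [X], [Y], [Z]. Hence [u] is a unit. *)
Lemma br_unit : exists u v, [/\ B u, B v, u * v = 1 & br X Z = u * (X ^+ m.+1 * Z)].
Proof.
have BX : B X by apply/genXYZ/genX.
have BY : B Y by apply/genXYZ/genY.
have BZ : B Z by apply/genXYZ/genZ.
(* For the triple [x], [y], [t] the common factor is [-1], by [br_xt]. *)
have [] := br_rel w derD1 derD2 x_neq0 t_neq0 rel_xyt.
rewrite br_xt mulNr divff ?mulf_neq0 ?expf_neq0 ?x_neq0 ?t_neq0 // !mulN1r.
move=> _ e_ty e_yx e1.
have Bb f g : B f -> B g -> B (br f g).
  move=> Bf Bg; suff [v Bv ->] : exists2 v, B v & br f g = 1 * v by rewrite mul1r.
  have Bx := genX c x y t; have By := genY c x y t; have Bt := genZ c x y t.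
  have Bxy : B (br x y).
    rewrite brC e_yx opprK; apply: genB; last exact: gen1.
    by apply: genM => //; apply: genXn.
  have Byt : B (br y t).
    rewrite brC e_ty opprK; apply: genB; last exact: gen1.
    by do 3?[apply: genM => //]; [exact: gen_nat | exact: genXn].
  have Bxt : B (br x t).
    by rewrite br_xt; apply: genN; apply: genM => //; apply: genXn.
  apply: br_ideal => //.
  - by exists (br x y); rewrite ?mul1r.
  - by exists (br y t); rewrite ?mul1r.
  - by exists (br x t); rewrite ?mul1r.
have := br_rel w derD1 derD2 nzX nzZ rel_XYZ; set u := _ / _ => -[eXZ eZY eYX eu].
have Bu : B u.
  rewrite eu; apply: genB; last exact: Bb.
  apply: genM; first by do 2?[apply: genM => //]; [exact: gen_nat | exact: genXn].
  by apply: genB; apply: genM => //; apply: Bb.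
exists u.
have I f g : B f -> B g -> exists2 v, B v & br f g = u * v.
  move=> /genXYZ Gf /genXYZ Gg.
  have [|||v Gv ->] := @br_ideal _ _ c X Y Z _ _ w derD1 derD2 D1c D2c u f g _ _ _ Gf Gg.
  - exists (- (X ^+ m.+1 * Y - 1)); last by rewrite brC eYX mulrN.
    apply: genN; apply: genB; last exact: gen1.
    by apply: genM; [apply: genXn; apply: genX | apply: genY].
  - exists (- (m.+1%:R * X ^+ m * Y * Z - 1)); last by rewrite brC eZY mulrN.
    apply: genN; apply: genB; last exact: gen1.
    apply: genM; last exact: genZ.
    apply: genM; last exact: genY.
    by apply: genM; [exact: gen_nat | apply: genXn; apply: genX].
  - exists (X ^+ m.+1 * Z) => //.
    by apply: genM; [apply: genXn; apply: genX | apply: genZ].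
  by exists v => //; apply/genXYZ.
have [v1 B1 ev1] := I _ _ (genX c x y t) (genZ c x y t).
have [v2 B2 ev2] := I _ _ (genY c x y t) (genX c x y t).
have [v3 B3 ev3] := I _ _ (genZ c x y t) (genY c x y t).
(* By [e1], [-1] is a combination of three brackets, each a multiple of [u]; dividing by [u] and
   changing the sign gives the inverse. *)
exists (- (n.+1%:R * x ^+ n * y * (y * v1 - t * v2) - v3)); split=> //.
  apply: genN; apply: genB => //; apply: genM.
    apply: genM; last exact: genY.
    by apply: genM; [exact: gen_nat | apply: genXn; apply: genX].
  by apply: genB; apply: genM => //; [exact: genY | exact: genZ].
rewrite br_xt in ev1.
by apply: oppr_inj; rewrite e1 ev1 ev2 ev3; ring.
Qed.

(** Since [y = (x + t - 1) / (x^(n+1) t)], elements of [B] are Laurent polynomials in [x], [t].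
    Allowing every larger exponent lets several elements share one denominator. *)
Lemma laurent f : B f -> exists N, forall N', (N <= N')%N ->
  exists P, (x * t) ^+ N' * f = E P.
Proof.
suff H : B f -> exists N P, (x * t) ^+ N * f = E P.
  move=> /H [N [P eP]]; exists N => N' le_N.
  exists ((polyx k * polyy k) ^+ (N' - N) * P).
  by rewrite rmorphM rmorphXn rmorphM Ex Et -eP mulrA -exprD subnK.
elim=> {f} [a||||f g _ [N [P eP]] _ [N' [Q eQ]]|f g _ [N [P eP]] _ [N' [Q eQ]]].
- by exists 0%N, (a%:P)%:P; rewrite Ec mul1r.
- by exists 0%N, (polyx k); rewrite Ex mul1r.
- exists n.+1, ((polyx k + polyy k - 1) * polyy k ^+ n).
  rewrite rmorphM rmorphXn rmorphB rmorphD rmorph1 Ex Et -rel_xyt exprMn (exprS t); ring.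
- by exists 0%N, (polyy k); rewrite Et mul1r.
- exists (N + N')%N, ((polyx k * polyy k) ^+ N' * P + (polyx k * polyy k) ^+ N * Q).
  by rewrite rmorphD !rmorphM !rmorphXn !rmorphM Ex Et -eP -eQ exprD; ring.
- exists (N + N')%N, (P * Q).
  by rewrite rmorphM -eP -eQ exprD; ring.
Qed.

(* [br X Z / (X * Z)], computed with the logarithmic bracket of the torus with
   coordinates [x], [t], has nonnegative order along every toric divisor. *)
Lemma unit_expX_monomial u : B u -> br X Z = u * (X ^+ m.+1 * Z) ->
  exists a, u * X ^+ m = c a * x ^+ n.
Proof.
move=> Bu eXZ.
have /laurent [N1 H1] := Bu.
have /laurent [N2 H2] : B X by apply/genXYZ/genX.
have /laurent [N3 H3] : B Z by apply/genXYZ/genZ.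
have [N [le1 le2 le3]] : exists N, [/\ N1 <= N, N2 <= N & N3 <= N]%N.
  by exists (N1 + N2 + N3)%N; split; lia.
have [U eU] := H1 N le1; have [P eP] := H2 N le2; have [Q eQ] := H3 N le3.
pose M0 := polyx k * polyy k; pose M := M0 ^+ N.
have eM : E M = (x * t) ^+ N by rewrite rmorphXn rmorphM Ex Et.
have nzM0 : M0 != 0 by rewrite mulf_neq0 ?polyC_eq0 ?polyX_eq0.
have nzM : M != 0 by rewrite expf_neq0.
rewrite -eM in eU eP eQ.
have nzP : P != 0 by rewrite -E_neq0 -eP mulf_neq0 ?E_neq0.
have nzQ : Q != 0 by rewrite -E_neq0 -eQ mulf_neq0 ?E_neq0.
(* This is [br_quot] with denominator [M]. In [br x t = - x^n (x t)] the factor [x t], here [M0],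
   turns each Jacobian into a logarithmic bracket, and [x^n] stays outside. *)
pose L := M * (M0 * jac P Q) - P * (M0 * jac M Q) - Q * (M0 * jac P M).
have brL : E M ^+ 3 * br X Z = - (x ^+ n * E L).
  rewrite br_quot // eP eQ.
  rewrite !(br_E P Q, br_E M Q, br_E P M) br_xt /L !(rmorphB, rmorphM) exprS Ex Et; ring.
have eqP : U * P ^+ m * (P * Q * M) = - (polyx k ^+ n * M ^+ m.+1 * L).
  apply: injE; rewrite rmorphN !rmorphM (rmorphXn E m P) (rmorphXn E m.+1 M) (rmorphXn E n) Ex.
  have -> : x ^+ n * E M ^+ m.+1 * E L = - (E M ^+ m.+1 * (- (x ^+ n * E L))) by ring.
  by rewrite -brL eXZ -eU -eP -eQ exprMn (exprS X) (exprS (E M) m); ring.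
(* As [U * P ^+ m] represents [M^(m+1) u X^m] with [M = (x t)^N], the expected monomial is
   [x^(n + N(m+1)) t^(N(m+1))]. For each weight, [eqP] bounds the product with [P], [Q] and [M], and
   their nonzero leading forms are then cancelled. *)
have [] := @fil_monomial _ (N * m.+1) (n + N * m.+1) (U * P ^+ m).
  move=> v.
  have [p filP topP] := fil_exact v nzP.
  have [q filQ topQ] := fil_exact v nzQ.
  have [r filM1 topM] := fil_exact v nzM.
  apply: (fil_cancel filP topP); apply: (fil_cancel filQ topQ).
  apply: (fil_cancel filM1 topM); rewrite -!mulrA [P * _]mulrA mulrA eqP.
  (* The explicit weight of [M] bounds the power [M ^+ m.+1]; inside [L] the bound [r] is used, to
     match the factor cancelled. *)
  have filM' : fil v ((v.2 + v.1) * N%:Z) M.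
    by apply: filX; apply: filM; [apply: fil_polyx | apply: fil_polyy].
  have filL : fil v (p + q + r) L.
    have -> : p + q + r = r + (p + q) by ring.
    apply: filB; first apply: filB.
    + by apply: filM => //; apply: fil_jac.
    + by rewrite addrCA; apply: filM => //; apply: fil_jac.
    + have -> : r + (p + q) = q + (p + r) by ring.
      by apply: filM => //; apply: fil_jac.
  have -> : wt v (N * m.+1) (n + N * m.+1) + p + q + r =
      v.2 * n%:Z + ((v.2 + v.1) * N%:Z) * m.+1%:Z + (p + q + r).
    by rewrite /wt; lia.
  by apply: filN; apply: filM => //; apply: filM; apply: filX => //; apply: fil_polyx.
move=> a /(congr1 E); rewrite !rmorphM !rmorphXn -eU -eP exprMn Ec Ex Et => e.
exists a; have nzEM : E M ^+ m.+1 != 0 by rewrite expf_neq0 ?E_neq0.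
apply: (mulfI nzEM).
have -> : E M ^+ m.+1 * (u * X ^+ m) = E M * u * (E M ^+ m * X ^+ m).
  by rewrite exprS; ring.
by rewrite e exprD eM -exprM exprMn; ring.
Qed.

End Rigidity.

(* Isomorphism as a relation, so that it can be inverted without choice. *)
Definition kalg_corr (k : Type) (F : fieldType) (c : k -> F) (P Q : F -> Prop)
    (r : F -> F -> Prop) :=
  [/\ (forall a b, r a b -> P a /\ Q b),
      (forall a, P a -> exists b, r a b) /\ (forall b, Q b -> exists a, r a b),
      (forall a b b', r a b -> r a b' -> b = b') /\
        (forall a a' b, r a b -> r a' b -> a = a'),
      (forall a, r (c a) (c a)) &
      (forall a b a' b', r a b -> r a' b' -> r (a + a') (b + b')) /\
        (forall a b a' b', r a b -> r a' b' -> r (a * a') (b * b'))].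

Lemma kalg_corr_sym (k : Type) (F : fieldType) (c : k -> F) P Q r :
  kalg_corr c P Q r -> kalg_corr c Q P (fun a b => r b a).
Proof.
case=> sub [tot sur] [fn inj] cst [add mul]; split=> //.
- by move=> a b /sub [].
- by split=> a *; [apply: (inj _ _ a) | apply: fn; eassumption].
- by split=> *; [apply: add | apply: mul].
Qed.

(** * The rings [B_n] inside a field with derivations extending the partial derivatives *)

Section Surface.
Variables (k F : fieldType) (iota : {rmorphism {poly {poly k}} -> F}).
Hypothesis injA : injective iota.
Variables Dx Dy : F -> F.
Hypotheses (derDx : derivation Dx) (derDy : derivation Dy).
Hypotheses (DxA : forall a, Dx (iota a) = iota (dpolyx a)).
Hypotheses (DyA : forall a, Dy (iota a) = iota a^`()).

Definition kc : k -> F := iota \o (polyC \o polyC).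

HB.instance Definition _ := GRing.RMorphism.on kc.

Let gx : F := iota (polyx k).
Let gy : F := iota (polyy k).

Lemma iota_eq0 a : (iota a == 0) = (a == 0).
Proof. by rewrite -(rmorph0 iota) (inj_eq injA). Qed.

Lemma gx_neq0 : gx != 0.
Proof. by rewrite iota_eq0 polyC_eq0 polyX_eq0. Qed.

Lemma gx_subr1 : gx - 1 = iota ('X - 1%:P)%:P.
Proof. by rewrite polyCB rmorphB rmorph1. Qed.

(* [den n], [slope n] and [affB n] have the exponent [n.+1] of [B_(n+1)]. *)
Definition den n : {poly {poly k}} := polyx k ^+ n.+1 * polyy k - 1.
Definition slope n : F := iota (polyx k - 1) / iota (den n).
Definition affB n (f : F) :=
  exists p : {poly {poly {poly k}}}, f = (map_poly iota p).[slope n].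

Section Fixed.
Variable n : nat.
Local Notation W := (den n).
Local Notation t := (slope n).

Lemma size_W : size W = 2.
Proof.
have nz : 'X ^+ n.+1 != 0 :> {poly k} by rewrite expf_neq0 ?polyX_eq0.
by rewrite /den /polyx -rmorphXn mul_polyC size_polyDl size_scale
  ?size_polyX ?size_polyN ?size_poly1.
Qed.

Lemma W_neq0 : iota W != 0 :> F.
Proof. by rewrite iota_eq0 -size_poly_gt0 size_W. Qed.

Lemma tnE : t * iota W = gx - 1.
Proof.
by rewrite divfK ?W_neq0 // rmorphB rmorph1.
Qed.

Lemma tn_neq0 : t != 0.
Proof.
rewrite -(can_eq (mulfK W_neq0)) tnE mul0r gx_subr1 iota_eq0.
by rewrite polyC_eq0 polyXsubC_eq0.
Qed.

Lemma tn_rel : gx ^+ n.+1 * gy * t = gx + t - 1.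
Proof.
have -> : gx ^+ n.+1 * gy = iota W + 1 by rewrite rmorphB rmorph1 rmorphM rmorphXn subrK.
by rewrite mulrDl mul1r mulrC tnE addrAC.
Qed.

(** Substitution of [t] for the outer variable: the embedding of [k[x,t]] that provides the torus
    coordinates. *)
Definition evalxt : {poly {poly k}} -> F := horner_eval t \o map_poly (@iota \o polyC).

HB.instance Definition _ := GRing.RMorphism.on evalxt.

Lemma evalxt_const a : evalxt (a%:P)%:P = kc a.
Proof. by rewrite /evalxt /= map_polyC /horner_eval hornerC. Qed.

Lemma evalxt_x : evalxt (polyx k) = gx.
Proof. by rewrite /evalxt /= map_polyC /horner_eval hornerC. Qed.

Lemma evalxt_y : evalxt (polyy k) = t.
Proof. by rewrite /evalxt /= map_polyX /horner_eval hornerX. Qed.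

(* Clearing the denominators [W ^ i] of [P(x,t)] gives [Q(W)] with [Q] over
   [k[x]]; and [W] is transcendental over [k[x]]. *)
Lemma evalxt_inj : injective evalxt.
Proof.
apply: raddf_inj => P /=; rewrite /evalxt /= /horner_eval /map_poly horner_poly.
set d := size P => e0.
pose Q : {poly {poly k}} := \sum_(i < d) (P`_i * ('X - 1%:P) ^+ i)%:P * 'X^(d - i).
have : Q \Po W == 0.
  rewrite -(inj_eq injA) rmorph0 -[X in _ == X](mulr0 (iota W ^+ d)) -e0.
  rewrite mulr_sumr 2!rmorph_sum /=; apply/eqP; apply: eq_bigr => i _.
  rewrite rmorphM /= comp_polyC comp_Xn_poly !rmorphM !rmorphXn /=.
  rewrite -[iota ('X - _)%:P]gx_subr1 -tnE.
  have -> : iota W ^+ d = iota W ^+ i * iota W ^+ (d - i).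
    by rewrite -exprD subnKC // ltnW.
  by rewrite exprMn; ring.
rewrite comp_poly_eq0 ?size_W // => /eqP Q0.
apply/polyP=> i; rewrite coef0; case: (ltnP i d) => [lt_i|]; last exact: nth_default.
(* The coefficient of [Q] at [d - i] is [P_i (x-1)^i], and [x - 1] is nonzero. *)
have := congr1 (fun q : {poly {poly k}} => q`_(d - i)) Q0.
rewrite coef0 coef_sum (bigD1 (Ordinal lt_i)) //= coefCM coefXn eqxx mulr1 big1 ?addr0.
  move/eqP; rewrite mulf_eq0 expf_eq0 polyXsubC_eq0 andbF orbF.
  by move/eqP.
move=> j /eqP nej; rewrite coefCM coefXn; case: eqP => [e|]; last by rewrite mulr0.
by case: nej; apply: val_inj => /=; move: (ltn_ord j) e; rewrite -/d; lia.
Qed.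

Lemma affB_gen f : affB n f <-> gen kc gx gy t f.
Proof.
split=> [[p ->]|].
  elim/poly_ind: p => [|p a IHp]; first by rewrite rmorph0 horner0; apply: gen0.
  rewrite rmorphD rmorphM /= map_polyX map_polyC hornerD hornerMX hornerC.
  apply: genD; first by apply: genM => //; apply: genZ.
  elim/polyxy_ind: a => [c|||a b IHa IHb|a b IHa IHb].
  - exact: genC.
  - exact: genX.
  - exact: genY.
  - by rewrite /= rmorphD; apply: genD.
  - by rewrite /= rmorphM; apply: genM.
elim=> {f} [a||||f g _ [p ->] _ [q ->]|f g _ [p ->] _ [q ->]].
- by exists ((a%:P)%:P)%:P; rewrite map_polyC hornerC.
- by exists (polyx k)%:P; rewrite map_polyC hornerC.
- by exists (polyy k)%:P; rewrite map_polyC hornerC.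
- by exists 'X; rewrite map_polyX hornerX.
- by exists (p + q); rewrite rmorphD hornerD.
- by exists (p * q); rewrite rmorphM hornerM.
Qed.

Lemma Dx_const a : Dx (kc a) = 0.
Proof. by rewrite DxA dpolyx_const rmorph0. Qed.

Lemma Dy_const a : Dy (kc a) = 0.
Proof. by rewrite DyA derivC rmorph0. Qed.

(** The bracket reduces to [W * Dy t], which is computed by differentiating [t W = x - 1] with
    respect to [y]. *)
Lemma br_x_tn : br Dx Dy (iota W) gx t = - (gx ^+ n.+1 * t).
Proof.
rewrite /br DxA DyA dpolyx_x derivC rmorph1 rmorph0 mul1r mul0r subr0.
have := congr1 Dy tnE; rewrite derDy.2.
rewrite gx_subr1 !DyA derivC rmorph0.
have -> : W^`() = polyx k ^+ n.+1.
  by rewrite derivB derivC subr0 /polyx -rmorphXn mul_polyC derivZ derivX alg_polyC.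
by rewrite rmorphXn => /eqP; rewrite addr_eq0 [Dy t * _]mulrC [t * _]mulrC => /eqP.
Qed.

(** * Orders of vanishing along [x = 0] *)

(** Restriction to the line [x = 0]; it is nonzero exactly on polynomials prime to [x]. *)
Definition at_x0 (p : {poly {poly k}}) : {poly k} := (swapXY p).[0].

Lemma at_x0M p q : at_x0 (p * q) = at_x0 p * at_x0 q.
Proof. by rewrite /at_x0 rmorphM hornerM. Qed.

Lemma at_x0_x : at_x0 (polyx k) = 0.
Proof. by rewrite /at_x0 swapXY_Y hornerX. Qed.

Lemma at_x0X p i : at_x0 (p ^+ i) = at_x0 p ^+ i.
Proof. by rewrite /at_x0 rmorphXn horner_exp. Qed.

Lemma at_x0_W : at_x0 W = -1.
Proof.
rewrite /den /at_x0 rmorphB rmorph1 rmorphM rmorphXn /= swapXY_Y !hornerE.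
by rewrite expr0n mul0r add0r.
Qed.

(** The only denominator is [W], whose restriction to [x = 0] is [-1]; so the ring lies in the local
    ring of the line [x = 0]. *)
Lemma gen_at_x0 f : gen kc gx gy t f ->
  exists p q, at_x0 q != 0 /\ f * iota q = iota p.
Proof.
have nz1 : at_x0 1 != 0 by rewrite /at_x0 rmorph1 hornerC oner_neq0.
elim=> {f} [a||||f g _ [p [q [nzq e]]] _ [p' [q' [nzq' e']]]|
  f g _ [p [q [nzq e]]] _ [p' [q' [nzq' e']]]].
- by exists (a%:P)%:P, 1; rewrite rmorph1 mulr1.
- by exists (polyx k), 1; rewrite rmorph1 mulr1.
- by exists (polyy k), 1; rewrite rmorph1 mulr1.
- exists (polyx k - 1), W; rewrite at_x0_W oppr_eq0 oner_neq0; split=> //.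
  by rewrite tnE rmorphB rmorph1.
- exists (p * q' + p' * q), (q * q'); rewrite at_x0M mulf_neq0 //; split=> //.
  by rewrite rmorphD !rmorphM -e -e' mulrDl mulrA [X in _ + g * X]mulrC mulrA.
- exists (p * p'), (q * q'); rewrite at_x0M mulf_neq0 //; split=> //.
  by rewrite !rmorphM -e -e' mulrACA.
Qed.

Lemma polyx_factor p : p != 0 -> exists i q, at_x0 q != 0 /\ p = polyx k ^+ i * q.
Proof.
move=> nzp; have [i [q nzq e]] := multiplicity_XsubC (swapXY p) 0.
exists i, (swapXY q); move: nzq; rewrite swapXY_eq0 nzp /root /at_x0 swapXYK.
split=> //; rewrite -[LHS]swapXYK e rmorphM rmorphXn /= subr0 swapXY_X.
by rewrite mulrC.
Qed.

Lemma polyx_factor_uniq i j p q : at_x0 p != 0 -> at_x0 q != 0 ->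
  polyx k ^+ i * p = polyx k ^+ j * q -> i = j.
Proof.
wlog le_ij : i j p q / (i <= j)%N.
  move=> H nzp nzq e; case/orP: (leq_total i j) => le; first exact: H e.
  by symmetry; apply: H (esym e).
move=> nzp nzq; rewrite -(subnKC le_ij) exprD -mulrA => /mulfI e.
case: (posnP (j - i)) => [->|lt_ij]; first by rewrite addn0.
case/eqP: nzp; rewrite e ?expf_neq0 ?polyC_eq0 ?polyX_eq0 //.
by rewrite at_x0M at_x0X at_x0_x expr0n eqn0Ngt lt_ij mul0r.
Qed.

Lemma gen_valuation f : gen kc gx gy t f -> f != 0 ->
  exists i p q, [/\ at_x0 p != 0, at_x0 q != 0 & f * iota q = gx ^+ i * iota p].
Proof.
move=> /gen_at_x0 [p [q [nzq e]]] nzf.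
have nz0 (r : {poly {poly k}}) : at_x0 r != 0 -> r != 0.
  by apply: contraNneq => ->; rewrite /at_x0 rmorph0 horner0.
have /polyx_factor [i [p' [nzp' ep]]] : p != 0.
  rewrite -(inj_eq injA) -e rmorph0 mulf_neq0 //.
  by rewrite -(rmorph0 iota) (inj_eq injA) nz0.
by exists i, p', q; split=> //; rewrite e ep rmorphM rmorphXn.
Qed.

(** Take orders along [x = 0], which are nonnegative on the ring: [u * v = 1] forces [u] to have
    order [0], and then [m] times the order of [X] is [n]. *)
Lemma dvd_of_expX_monomial m u v X a :
    gen kc gx gy t u -> gen kc gx gy t v ->
    gen kc gx gy t X -> u * v = 1 -> X != 0 ->
  u * X ^+ m = kc a * gx ^+ n -> (m %| n)%N.
Proof.
move=> Bu Bv BX uv1 nzX e.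
have nzu : u != 0 by apply: contra_eq_neq uv1 => ->; rewrite mul0r eq_sym oner_neq0.
have nzv : v != 0 by apply: contra_eq_neq uv1 => ->; rewrite mulr0 eq_sym oner_neq0.
have [i [p [q [nzp nzq eu]]]] := gen_valuation Bu nzu.
have [i' [p' [q' [nzp' nzq' ev]]]] := gen_valuation Bv nzv.
have [j [r [s [nzr nzs eX]]]] := gen_valuation BX nzX.
have nza : a != 0.
  apply/eqP => a0; move/eqP: e; rewrite a0 rmorph0 mul0r mulf_eq0 expf_eq0.
  by rewrite (negPf nzu) (negPf nzX) andbF.
have /polyx_factor_uniq : polyx k ^+ 0 * (q * q') = polyx k ^+ (i + i') * (p * p').
  apply: injA; rewrite mul1r exprD !rmorphM !rmorphXn /= -/gx mulrACA -eu -ev.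
  by rewrite mulrACA uv1 mul1r.
rewrite !at_x0M !mulf_neq0 // => /(_ isT isT) /esym/eqP.
rewrite addn_eq0 => /andP[/eqP i0 _].
have /polyx_factor_uniq : polyx k ^+ (i + j * m) * (p * r ^+ m) =
    polyx k ^+ n * ((a%:P)%:P * (q * s ^+ m)).
  apply: injA; rewrite exprD !rmorphM !rmorphXn /= -/gx exprM mulrACA -eu.
  by rewrite -exprMn -eX exprMn mulrACA e [kc a * _]mulrC -mulrA.
rewrite i0 add0n => <-; first exact: dvdn_mull.
  by rewrite at_x0M at_x0X mulf_neq0 // expf_neq0.
rewrite !at_x0M at_x0X !mulf_neq0 ?expf_neq0 //.
by rewrite /at_x0 swapXY_polyC map_polyC hornerC polyC_eq0.
Qed.

End Fixed.

(** The partners [X], [Y], [Z] of the generators inherit their relation and generate the target, so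
    the bracket comparison applies. The rings are [B_(m+1)] and [B_(n+1)]. *)
Lemma kalg_corr_dvdn m n r :
  kalg_corr kc (affB m) (affB n) r -> (m %| n)%N.
Proof.
case=> sub [tot sur] [fn inj] cst [add mul].
have [X rX] := tot gx ((affB_gen m gx).2 (genX _ _ _ _)).
have [Y rY] := tot gy ((affB_gen m gy).2 (genY _ _ _ _)).
have [Z rZ] := tot (slope m) ((affB_gen m _).2 (genZ _ _ _ _)).
have r1 : r 1 1 by have := cst 1; rewrite !rmorph1.
have r0 : r 0 0 by have := cst 0; rewrite !rmorph0.
have rN1 : r (-1) (-1) by have := cst (-1); rewrite !rmorphN1.
have nzX : X != 0.
  by apply/eqP => X0; have /eqP := gx_neq0; apply; apply: inj r0; rewrite -X0.
have nzZ : Z != 0.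
  by apply/eqP => Z0; have /eqP := tn_neq0 m; apply; apply: inj r0; rewrite -Z0.
have rXn i : r (gx ^+ i) (X ^+ i).
  by elim: i => [|i IHi] //; rewrite !exprS; apply: mul.
have rel : X ^+ m.+1 * Y * Z = X + Z - 1.
  apply: (fn (gx ^+ m.+1 * gy * slope m)); first by do 2!apply: (mul _ _ _ _) => //.
  by rewrite tn_rel; do 2!apply: (add _ _ _ _) => //.
have genXYZ g : gen kc X Y Z g <-> gen kc gx gy (slope n) g.
  rewrite -(affB_gen n g); split=> [G | /sur [a rag]].
    suff [a /sub []] : exists a, r a g by [].
    elim: G => [c||||h h' _ [a ra] _ [a' ra']|h h' _ [a ra] _ [a' ra']].
    - by exists (kc c).
    - by exists gx.
    - by exists gy.
    - by exists (slope m).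
    - by exists (a + a'); apply: add.
    - by exists (a * a'); apply: mul.
  have [/affB_gen Ga _] := sub _ _ rag.
  suff [b Gb rab] : exists2 b, gen kc X Y Z b & r a b by rewrite (fn _ _ _ rag rab).
  elim: Ga => [c||||h h' _ [b Gb rb] _ [b' Gb' rb']|h h' _ [b Gb rb] _ [b' Gb' rb']].
  - by exists (kc c) => //; apply: genC.
  - by exists X => //; apply: genX.
  - by exists Y => //; apply: genY.
  - by exists Z => //; apply: genZ.
  - by exists (b + b'); [apply: genD | apply: add].
  - by exists (b * b'); [apply: genM | apply: mul].
have [u [v [Bu Bv uv1 eXZ]]] := br_unit (@evalxt_inj n) (evalxt_x n) (evalxt_y n)
  derDx derDy Dx_const Dy_const (tn_rel n) (br_x_tn n) rel nzX nzZ genXYZ.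
have [a ea] := unit_expX_monomial (@evalxt_inj n) (evalxt_const n) (evalxt_x n) (evalxt_y n)
  derDx derDy Dx_const Dy_const (tn_rel n) (br_x_tn n) nzX nzZ genXYZ Bu eXZ.
by apply: dvd_of_expX_monomial Bu Bv _ uv1 nzX ea; apply/genXYZ/genX.
Qed.

End Surface.

(** * Application to [k(x,y)] and conclusion *)

Lemma kalg_iso_corr (k : fieldType) (P Q : Kxy k -> Prop) :
    P 1 -> (forall c, P (kconst c)) ->
    (forall a b, P a -> P b -> P (a + b)) -> (forall a b, P a -> P b -> P (a * b)) ->
  kalg_iso P Q -> exists r, kalg_corr (@kconst k) P Q r.
Proof.
move=> P1 Pc PD PM [f [[fQ fD fM f1 fc] [inj sur]]].
(* The map [f] is controlled only on [P], so its graph is restricted to [P]. *)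
exists (fun a b => P a /\ b = f a); split.
- by move=> a b [Pa ->]; split=> //; apply: fQ.
- by split=> [a Pa | b /sur [a Pa <-]]; [exists (f a) | exists a].
- by split=> [a b b' [_ ->] [_ ->] | a a' b [Pa ->] [Pa' /inj]] //; apply.
- by move=> c; split=> //; rewrite -[kconst c]mulr1 fc // f1 mulr1.
- by split=> a _ a' _ [Pa ->] [Pa' ->]; rewrite ?fD ?fM //; split=> //; [apply: PD | apply: PM].
Qed.

Lemma kalg_corr_inB_dvdn (k : fieldType) m n r :
  kalg_corr (@kconst k) (@inB k m.+1) (@inB k n.+1) r -> (m %| n)%N.
Proof.
pose R := {poly {poly k}}.
apply: (@kalg_corr_dvdn k {fraction R} (@FracField.tofrac R)
  _ (frac_der (@dpolyx k)) (frac_der (@deriv {poly k}))).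
- by move=> a b /eqP; rewrite tofrac_eq => /eqP.
- exact: frac_der_derivation (dpolyx_derivation k).
- exact: frac_der_derivation (deriv_derivation _).
- exact: frac_der_tofrac (dpolyx_derivation k).
- exact: frac_der_tofrac (deriv_derivation _).
Qed.

Lemma inB_gen (k : fieldType) n (f : Kxy k) : inB n.+1 f <->
  gen (@kconst k) (inA (polyx k)) (inA (polyy k)) (tn k n.+1) f.
Proof.
apply: (@affB_gen k {fraction {poly {poly k}}} (@FracField.tofrac {poly {poly k}})).
Qed.

Theorem theorem4p1 (k : fieldType) (m n : nat) :
  (1 <= m)%N -> (1 <= n)%N -> kalg_iso (@inB k m) (@inB k n) -> m = n.
Proof.
case: m n => [|m] [|n] // _ _ iso.
have [r corr] : exists r, kalg_corr (@kconst k) (@inB k m.+1) (@inB k n.+1) r.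
  apply: kalg_iso_corr iso.
  - apply/inB_gen; rewrite -[1](tofrac1 {poly {poly k}}); exact: (genC (@kconst k) _ _ _ 1).
  - by move=> c; apply/inB_gen/genC.
  - by move=> a b /inB_gen Ba /inB_gen Bb; apply/inB_gen/genD.
  - by move=> a b /inB_gen Ba /inB_gen Bb; apply/inB_gen/genM.
(* Equality follows from divisibility both ways between the exponents lowered by one, including the
   value [0]. *)
congr S; apply/eqP; rewrite eqn_dvd (kalg_corr_inB_dvdn corr) /=.
exact: kalg_corr_inB_dvdn (kalg_corr_sym corr).
Qed.
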